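(* Let $X_1,\dots,X_m\in\mathbb{M}_n$ be such that their sum $\sum_{k=1}^m X_k$ is polar Hermitian. Then, for all symmetric norms $\|\cdot\|$ on $\mathbb{M}_n$, $$ \left\|\,\left|\sum_{k=1}^m X_k\right|_{\mathrm{sym}}\right\|\le\left\|\sum_{k=1}^m |X_k|_{\mathrm{sym}}\right\|. $$
   Context: $\mathbb{M}_n$ is the space of complex $n\times n$ matrices. For $Z\in\mathbb{M}_n$, $|Z|=(Z^*Z)^{1/2}$ and $|Z|_{\mathrm{sym}}=\frac{|Z|+|Z^*|}{2}$. A matrix $S\in\mathbb{M}_n$ is called polar Hermitian if it has a polar decomposition $S=V|S|$ (with $V$ unitary) in which $V$ is a scalar multiple of a Hermitian unitary. A symmetric norm is a unitarily invariant norm on $\mathbb{M}_n$, i.e. a norm with $\|UAV\|=\|A\|$ for all $A\in\mathbb{M}_n$ and all unitaries $U,V\in\mathbb{M}_n$. *)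

(* Defs.v *)
From mathcomp Require Import all_boot all_order all_algebra.
From mathcomp Require Import reals complex.

Set Implicit Arguments.
Unset Strict Implicit.
Unset Printing Implicit Defensive.

Import Order.TTheory GRing.Theory Num.Theory.
Local Open Scope ring_scope.
Local Open Scope sesquilinear_scope.

Section AbsoluteValue.
Variables (C : numClosedFieldType) (n : nat).
Implicit Types A B Z S : 'M[C]_n.

Definition psdmx A : Prop :=
  A \is hermsymmx /\ forall v : 'cV[C]_n, 0 <= (v^t* *m A *m v) 0 0.

(* The square root of a positive semidefinite matrix, by functional calculus;
   the value on other matrices is irrelevant. *)
Definition sqrtmx A : 'M[C]_n :=
  invmx (spectralmx A) *m diag_mx (map_mx sqrtC (spectral_diag A))
    *m spectralmx A.

Definition absmx Z : 'M[C]_n := sqrtmx (Z^t* *m Z).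

Definition symabsmx Z : 'M[C]_n := 2^-1 *: (absmx Z + absmx (Z^t*)).

Definition polar_hermitian S : Prop :=
  exists V : 'M[C]_n,
    [/\ V \is unitarymx,
        S = V *m absmx S
      & exists (c : C) (H : 'M[C]_n),
          [/\ H \is hermsymmx, H \is unitarymx & V = c *: H]].

Lemma hermsymmxE A : A \is hermsymmx <-> A = A^t*.
Proof.
by split=> [/is_hermitianmxP|] E; [|apply/is_hermitianmxP];
   rewrite expr0 scale1r in E *.
Qed.

Lemma psdmx_diag (P : 'M[C]_n) (d : 'rV[C]_n) :
  P \is unitarymx -> (forall i, 0 <= d 0 i) ->
  psdmx (invmx P *m diag_mx d *m P).
Proof.
move=> PU d0; rewrite invmx_unitary //; split.
  apply/hermsymmxE; rewrite !trmx_mul !map_mxM tr_diag_mx map_diag_mx trmxCK mulmxA.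
  congr (_ *m diag_mx _ *m _); apply/rowP=> i; rewrite mxE.
  by apply: esym; apply: conj_Creal; apply: ger0_real.
move=> v; set w := P *m v.
have -> : v^t* *m (P^t* *m diag_mx d *m P) *m v = w^t* *m diag_mx d *m w.
  by rewrite /w trmx_mul map_mxM !mulmxA.
rewrite mxE sumr_ge0 // => i _; rewrite mul_mx_diag !mxE.
by rewrite mulrAC mulrC mulr_ge0 // mulrC mul_conjC_ge0.
Qed.

Lemma psdmx_spectral A : psdmx A ->
  A = invmx (spectralmx A) *m diag_mx (spectral_diag A) *m spectralmx A /\
  forall i, 0 <= spectral_diag A 0 i.
Proof.
case=> Ah A0; have /orthomx_spectralP E := hermitian_normalmx Ah.
split=> // i; have := A0 ((spectralmx A)^t* *m delta_mx i 0).
have PU := spectral_unitarymx A.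
have PP : spectralmx A *m (spectralmx A)^t* = 1%:M by apply/unitarymxP.
rewrite [X in _ *m X *m _]E invmx_unitary // trmx_mul map_mxM trmxCK !mulmxA.
rewrite -(mulmxA _ (spectralmx A)) PP mulmx1 -(mulmxA _ (spectralmx A)) PP mulmx1.
rewrite -[_ *m delta_mx i 0]colE mxE trmx_delta map_delta_mx -rowE !mxE eqxx.
by rewrite mulr1n.
Qed.

Lemma sqrtmx_psd A : psdmx A -> psdmx (sqrtmx A).
Proof.
case/psdmx_spectral=> _ d0; apply: psdmx_diag; first exact: spectral_unitarymx.
by move=> i; rewrite mxE sqrtC_ge0.
Qed.

Lemma sqrtmxK A : psdmx A -> sqrtmx A *m sqrtmx A = A.
Proof.
case/psdmx_spectral=> E _; rewrite [RHS]E /sqrtmx !mulmxA mulmxK ?spectral_unit //.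
rewrite -(mulmxA _ (diag_mx _) (diag_mx _)) mulmx_diag; congr (_ *m diag_mx _ *m _).
by apply/rowP=> i; rewrite !mxE -expr2 sqrtCK.
Qed.

Lemma psdmx_sqr_inj A B : psdmx A -> psdmx B -> A *m A = B *m B -> A = B.
Proof.
case/psdmx_spectral; set P := spectralmx A; set d := spectral_diag A => EA d0.
case/psdmx_spectral; set Q := spectralmx B; set e := spectral_diag B => EB e0.
have uP : P \in unitmx := spectral_unit A.
have uQ : Q \in unitmx := spectral_unit B.
have sq (M : 'M[C]_n) (f : 'rV[C]_n) : M \in unitmx ->
    (invmx M *m diag_mx f *m M) *m (invmx M *m diag_mx f *m M) =
    invmx M *m diag_mx (\row_i f 0 i ^+ 2) *m M.
  move=> uM; rewrite !mulmxA mulmxK // -(mulmxA _ (diag_mx _) (diag_mx _)) mulmx_diag.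
  by congr (_ *m diag_mx _ *m _); apply/rowP=> i; rewrite !mxE.
have inter (f g : 'rV[C]_n) :
    invmx P *m diag_mx f *m P = invmx Q *m diag_mx g *m Q <->
    diag_mx f *m (P *m invmx Q) = (P *m invmx Q) *m diag_mx g.
  split=> E.
    have := congr1 (fun M => P *m M *m invmx Q) E.
    by rewrite !mulmxA mulmxV // mul1mx mulmxK.
  have := congr1 (fun M => invmx P *m M *m Q) E.
  by rewrite !mulmxA mulmxKV // mulVmx // mul1mx.
rewrite EA EB !sq // => /inter /matrixP E; apply/inter/matrixP=> i j.
move: (E i j); rewrite !mul_diag_mx !mul_mx_diag.
rewrite mxE [X in _ = X -> _]mxE mxE [X in _ = X -> _]mulrC !mxE.
rewrite [_ * e 0 j]mulrC; move: (\sum_(_ | _) _) => w.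
have [->|w0] := eqVneq w 0; first by rewrite !mulr0.
by move=> /(mulIf w0) /eqP; rewrite eqrXn2 // => /eqP->.
Qed.

Lemma psdmx_gram Z : psdmx (Z^t* *m Z).
Proof.
split; first by apply/hermsymmxE; rewrite trmx_mul map_mxM trmxCK.
move=> v; rewrite !mulmxA -map_mxM -trmx_mul -mulmxA mxE sumr_ge0 // => i _.
by rewrite !mxE mulrC mul_conjC_ge0.
Qed.

(* These two lemmas say that [absmx Z] is the unique positive semidefinite
   matrix whose square is [Z^t* *m Z]. *)
Lemma absmxP Z : psdmx (absmx Z) /\ absmx Z *m absmx Z = Z^t* *m Z.
Proof. by split; [apply: sqrtmx_psd|apply: sqrtmxK]; apply: psdmx_gram. Qed.

Lemma absmx_unique Z A : psdmx A -> A *m A = Z^t* *m Z -> A = absmx Z.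
Proof.
by case: (absmxP Z) => Z0 ZZ A0 AA; apply: psdmx_sqr_inj; rewrite ?ZZ.
Qed.

End AbsoluteValue.

Record symmetric_norm (R : realType) (n : nat) (N : 'M[R[i]]_n -> R) : Prop :=
  SymmetricNorm {
    symmetric_norm_eq0 : forall A, N A = 0 -> A = 0;
    symmetric_normZ : forall (a : R[i]) A, N (a *: A) = Normc.normc a * N A;
    symmetric_normD : forall A B, N (A + B) <= N A + N B;
    symmetric_norm_unitary : forall U A V,
      U \is unitarymx -> V \is unitarymx -> N (U *m A *m V) = N A
  }.

(* Main.v *)
Require Import Defs.
From mathcomp Require Import all_boot all_order all_algebra.
From mathcomp Require Import reals complex.
From mathcomp Require Import ring.

(** Write S for the sum of the X_k, T for the sum of the |X_k|_sym, and
    A <= B for positive semidefiniteness of B - A.  The norm inequality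
    comes from an inequality between matrices:

      |S|_sym <= (T + V T V^* ) / 2,   where S = V |S|, V = c H is the given
                                       polar decomposition.

    For one matrix X and any V, the absolute values dominate the real part:

      V^* X + X^* V <= V^* |X^*| V + |X|        ([psdmx_polar_gap]).

    Indeed, if X = W |X| and |X^*| = W |X| W^*, the difference of the two
    sides is the congruence Y^* |X| Y with Y = W^* V - 1.  Taking V from the
    polar decomposition of S and summing over the X_k, the left-hand side
    becomes 2 |S|.  Conjugating the result by V bounds 2 |S^*| = 2 V |S| V^*.
    In the average of the two bounds, V^* (.) V occurs on the |X_k^*| and
    V (.) V^* on the |X_k|.  As V is a multiple of a Hermitian matrix, these
    two conjugations agree, so the average is expressed through T alone
    ([symabsmx_sum_le]).

    A symmetric norm is monotone on positive semidefinite matrices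
    ([norm_psdmx_le]), and the norm of (T + V T V^* ) / 2 is at most that of T
    by the triangle inequality and unitary invariance.  For monotonicity,
    work in an eigenbasis of the smaller matrix, where the larger one
    dominates it on the diagonal.  Deleting the off-diagonal
    entries of the larger matrix ([norm_pinching]) and then shrinking its
    diagonal ([norm_row_scaling]) are both obtained by averaging with
    unitary sign changes, which does not increase the norm. *)

Set Implicit Arguments.
Unset Strict Implicit.
Unset Printing Implicit Defensive.

Import Order.TTheory GRing.Theory Num.Theory.

Local Open Scope ring_scope.

(** * Loewner order and absolute values *)

Section Positivity.
Local Open Scope sesquilinear_scope.
Variables (C : numClosedFieldType) (n : nat).
Implicit Types A B P U V Y Z : 'M[C]_n.

Lemma adjmxM m p q (A : 'M[C]_(m, p)) (B : 'M[C]_(p, q)) :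
  (A *m B)^t* = B^t* *m A^t*.
Proof. by rewrite trmx_mul map_mxM. Qed.

Lemma adjmxD A B : (A + B)^t* = A^t* + B^t*.
Proof. by rewrite linearD map_mxD. Qed.

Lemma adjmxB A B : (A - B)^t* = A^t* - B^t*.
Proof. by rewrite linearB map_mxB. Qed.

Lemma adjmxZ (c : C) A : (c *: A)^t* = c^* *: A^t*.
Proof. by rewrite linearZ map_mxZ. Qed.

Lemma adjmx1 : (1%:M : 'M[C]_n)^t* = 1%:M.
Proof. by rewrite trmx1 map_mx1. Qed.

Lemma psdmx_adj A : psdmx A -> A^t* = A.
Proof. by case=> /hermsymmxE <-. Qed.

Lemma unitarymx_mulmxV U : U \is unitarymx -> U *m U^t* = 1%:M.
Proof. by move/unitarymxP. Qed.

Lemma unitarymx_mulVmx U : U \is unitarymx -> U^t* *m U = 1%:M.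
Proof. by move=> uU; rewrite -invmx_unitary // mulVmx // unitarymx_unit. Qed.

Lemma psdmx0 : psdmx (0 : 'M[C]_n).
Proof.
split; first by apply/hermsymmxE; rewrite trmx0 map_mx0.
by move=> v; rewrite mulmx0 mul0mx mxE.
Qed.

Lemma psdmxD A B : psdmx A -> psdmx B -> psdmx (A + B).
Proof.
move=> pA pB; split.
  by apply/hermsymmxE; rewrite adjmxD (psdmx_adj pA) (psdmx_adj pB).
by move=> v; rewrite mulmxDr mulmxDl mxE addr_ge0 ?pA.2 ?pB.2.
Qed.

Lemma psdmx_sum (I : finType) (F : I -> 'M[C]_n) :
  (forall i, psdmx (F i)) -> psdmx (\sum_i F i).
Proof. by move=> pF; apply: big_ind => //; [exact: psdmx0|exact: psdmxD]. Qed.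

Lemma psdmxZ (c : C) A : 0 <= c -> psdmx A -> psdmx (c *: A).
Proof.
move=> c0 pA; split.
  by apply/hermsymmxE; rewrite adjmxZ (psdmx_adj pA) conj_Creal ?ger0_real.
by move=> v; rewrite -scalemxAr -scalemxAl mxE mulr_ge0 ?pA.2.
Qed.

Lemma psdmx_congr A Y : psdmx A -> psdmx (Y^t* *m A *m Y).
Proof.
move=> pA; split.
  by apply/hermsymmxE; rewrite !adjmxM trmxCK (psdmx_adj pA) mulmxA.
by move=> v; have := pA.2 (Y *m v); rewrite adjmxM !mulmxA.
Qed.

Lemma psdmx_diag_ge0 A i : psdmx A -> 0 <= A i i.
Proof.
move=> pA; have := pA.2 (delta_mx i 0).
by rewrite -mulmxA -colE trmx_delta map_delta_mx -rowE !mxE.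
Qed.

(** Inverting the nonzero eigenvalues in a spectral decomposition gives a
    Hermitian pseudo-inverse; the convention that 0 has inverse 0 takes care
    of the kernel. *)
Lemma psdmx_pinv P : psdmx P -> exists G : 'M[C]_n,
  [/\ G^t* = G, P *m G = G *m P & P *m G *m P = P].
Proof.
move=> pP; have [E d0] := psdmx_spectral pP.
have uU := spectral_unitarymx P; set U := spectralmx P in uU E.
set d := spectral_diag P in E d0.
pose D (f : C -> C) := U^t* *m diag_mx (map_mx f d) *m U.
have DM f g : D f *m D g = D (fun x => f x * g x).
  rewrite /D !mulmxA -(mulmxA (_ *m diag_mx _)) (unitarymx_mulmxV uU) mulmx1.
  rewrite -(mulmxA _ (diag_mx _) (diag_mx _)) mulmx_diag.
  by congr (_ *m diag_mx _ *m _); apply/rowP=> i; rewrite !mxE.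
have DE f g : f =1 g -> D f = D g.
  move=> fg; rewrite /D; congr (_ *m diag_mx _ *m _); apply/rowP=> i.
  by rewrite !mxE fg.
have PE : P = D id by rewrite /D (map_mx_id (f := id)) // -(invmx_unitary uU).
exists (D GRing.inv); rewrite {}PE; split.
- rewrite /D !adjmxM trmxCK tr_diag_mx map_diag_mx mulmxA.
  congr (_ *m diag_mx _ *m _); apply/rowP=> i; rewrite !mxE.
  by apply: conj_Creal; rewrite realV ger0_real.
- by rewrite !DM; apply: DE => x; rewrite mulrC.
- rewrite !DM; apply: DE => x.
  by have [->|x0] := eqVneq x 0; rewrite ?mulr0 // mulfV ?mul1r.
Qed.

Lemma gram_eq0 Z : Z^t* *m Z = 0 -> Z = 0.
Proof.
move=> Z0; apply/matrixP=> i j; rewrite [RHS]mxE.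
have /eqP := congr1 (fun M : 'M[C]_n => M j j) Z0.
rewrite !mxE psumr_eq0 => [/allP/(_ i (mem_index_enum i))|k _]; rewrite !mxE.
  by rewrite mulrC mul_conjC_eq0 => /eqP.
by rewrite mulrC mul_conjC_ge0.
Qed.

(** A polar decomposition with a partial isometry W = Z |Z|^+.  The kernels of
    Z and |Z| coincide, so the projection |Z|^+ |Z| acts as the identity on the
    right of Z; the second identity follows by uniqueness of the positive
    square root of Z Z^*. *)
Lemma absmx_polar Z : exists W : 'M[C]_n,
  Z = W *m absmx Z /\ absmx (Z^t*) = W *m absmx Z *m W^t*.
Proof.
have [pP PP] := absmxP Z; move: (absmx Z) pP PP => P pP PP.
have [G [Ga PG PGP]] := psdmx_pinv pP; exists (Z *m G).
have ZE : Z = Z *m G *m P.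
  apply/eqP; rewrite -subr_eq0; apply/eqP/gram_eq0.
  rewrite adjmxB !adjmxM Ga (psdmx_adj pP) mulmxBl !mulmxBr !mulmxA -PP.
  rewrite -(mulmxA _ (Z^t*) Z) -PP.
  have PPGP : P *m P *m G *m P = P *m P by rewrite -!mulmxA (mulmxA P G P) PGP.
  by rewrite (mulmxA _ P P) PGP !PPGP !subrr.
split=> //; rewrite -ZE adjmxM Ga; apply/esym/absmx_unique.
  have -> : Z *m (G *m Z^t*) = (Z *m G)^t*^t* *m P *m (Z *m G)^t*.
    by rewrite trmxCK -ZE adjmxM Ga.
  exact: psdmx_congr.
rewrite trmxCK !mulmxA -(mulmxA (Z *m G) (Z^t*) Z) -PP mulmxA -ZE.
by congr (_ *m _); rewrite -mulmxA PG mulmxA -ZE.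
Qed.

(** The difference is Y^* |Z| Y with Y = W^* V - 1, for the W of
    [absmx_polar].  It is the compression by (V, -1) of the positive
    semidefinite block matrix with diagonal blocks |Z^*|, |Z| and
    off-diagonal blocks Z, Z^*. *)
Lemma psdmx_polar_gap V Z :
  psdmx (V^t* *m absmx (Z^t*) *m V + absmx Z - (V^t* *m Z + Z^t* *m V)).
Proof.
have [W [ZE ZsE]] := absmx_polar Z; have [pP _] := absmxP Z.
rewrite {}ZsE; move: (absmx Z) ZE pP => P -> pP.
have := psdmx_congr (W^t* *m V - 1%:M) pP; congr psdmx.
rewrite adjmxM adjmxB adjmx1 adjmxM trmxCK (psdmx_adj pP).
rewrite mulmxBl mul1mx mulmxBr mulmx1 mulmxBl !mulmxA.
by rewrite opprB addrACA opprD (addrC (- _)).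
Qed.

Lemma absmx_adj_polar V Z : V \is unitarymx -> Z = V *m absmx Z ->
  absmx (Z^t*) = V *m absmx Z *m V^t*.
Proof.
move=> uV ZE; have [pP PP] := absmxP Z; move: (absmx Z) pP PP ZE => P pP PP ZE.
apply/esym/absmx_unique.
  by have := psdmx_congr (V^t*) pP; rewrite trmxCK.
rewrite trmxCK [in RHS]ZE adjmxM (psdmx_adj pP) !mulmxA.
by rewrite -(mulmxA _ (V^t*) V) unitarymx_mulVmx // mulmx1.
Qed.

Lemma psdmx_symabsmx Z : psdmx (symabsmx Z).
Proof.
apply: psdmxZ; first by rewrite invr_ge0 ler0n.
by apply: psdmxD; exact: (absmxP _).1.
Qed.

(** Sum [psdmx_polar_gap] over the X_k, add the conjugate of the result by V,
    and divide by 4. *)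
Lemma symabsmx_sum_le m (X : 'I_m -> 'M[C]_n) :
  polar_hermitian (\sum_k X k) ->
  exists2 V, V \is unitarymx &
    psdmx (2^-1 *: (\sum_k symabsmx (X k)
                    + V *m (\sum_k symabsmx (X k)) *m V^t*)
           - symabsmx (\sum_k X k)).
Proof.
set S := \sum_k X k => -[V [uV SE [c [H [hH _ VE]]]]]; exists V => //.
pose A := \sum_k absmx ((X k)^t*); pose B := \sum_k absmx (X k).
have TE : \sum_k symabsmx (X k) = 2^-1 *: (B + A).
  by rewrite -scaler_sumr big_split.
have SsE := absmx_adj_polar uV SE; have [pS _] := absmxP S.
have VVs := unitarymx_mulmxV uV.
have VS : V^t* *m S = absmx S by rewrite {1}SE mulmxA unitarymx_mulVmx ?mul1mx.
have SV : S^t* *m V = absmx S.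
  by rewrite -[LHS]trmxCK adjmxM trmxCK VS psdmx_adj.
(* The only place where V = c H with H Hermitian is used; both sides equal
   |c|^2 H A H. *)
have VA : V^t* *m A *m V = V *m A *m V^t*.
  have Ha : H^t* = H by move/hermsymmxE: hH.
  by rewrite VE adjmxZ Ha -!scalemxAl -!scalemxAr !scalerA mulrC.
have pM : psdmx (V^t* *m A *m V + B - (absmx S + absmx S)).
  have := psdmx_sum (fun k => psdmx_polar_gap V (X k)); congr psdmx.
  have SsumE : S^t* = \sum_k (X k)^t*.
    rewrite /S; elim/big_rec2: _ => [|k _ U _ <-]; rewrite ?adjmxD //.
    by rewrite trmx0 map_mx0.
  rewrite sumrB !big_split /= -!mulmx_suml -!mulmx_sumr.
  by rewrite -SsumE SV -/S VS.
have := psdmxD pM (psdmx_congr (V^t*) pM); rewrite trmxCK.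
move/(@psdmxZ (4%:R^-1) _ _); rewrite invr_ge0 ler0n => /(_ isT); congr psdmx.
rewrite TE /symabsmx SsE VA !mulmxBr !mulmxDr !mulmxBl !mulmxDl.
rewrite -scalemxAr -scalemxAl mulmxDr mulmxDl.
have -> : V *m (V *m A *m V^t*) *m V^t* = A.
  by rewrite -VA !mulmxA VVs mul1mx -mulmxA VVs mulmx1.
move: (absmx S) (V *m absmx S *m _) (V *m A *m _) (V *m B *m _) => Q Q' A' B'.
by apply/matrixP=> i j; rewrite !mxE; field.
Qed.

End Positivity.

(** * Monotonicity of symmetric norms *)

Section NormMonotonicity.
Local Open Scope sesquilinear_scope.
Variables (R : realType) (n : nat) (N : 'M[R[i]]_n -> R).
Hypothesis hN : symmetric_norm N.
Local Notation C := R[i].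
Implicit Types A B U V : 'M[C]_n.

Lemma normc_of_ge0 (x : C) : 0 <= x -> (Normc.normc x)%:C%C = x.
Proof. by move=> x0; rewrite -[RHS](ger0_norm x0) normc_def; case: x x0. Qed.

(** The averaging principle from which the other norm bounds are drawn. *)
Lemma norm_convex_unitary (s : C) A U V : 0 <= s -> s <= 1 ->
  U \is unitarymx -> V \is unitarymx ->
  N (s *: A + (1 - s) *: (U *m A *m V)) <= N A.
Proof.
move=> s0 s1 uU uV; have s'0 : 0 <= 1 - s by rewrite subr_ge0.
apply: (le_trans (symmetric_normD hN _ _)).
rewrite !(symmetric_normZ hN) (symmetric_norm_unitary hN) // -mulrDl.
suff -> : Normc.normc s + Normc.normc (1 - s) = 1 by rewrite mul1r.
by apply: complexI; rewrite rmorphD /= !normc_of_ge0 // subrKC.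
Qed.

Lemma norm_average A U V : U \is unitarymx -> V \is unitarymx ->
  N (2^-1 *: (A + U *m A *m V)) <= N A.
Proof.
move=> uU uV; have half : 1 - 2^-1 = 2^-1 :> C by field.
rewrite scalerDr -[X in _ + X *: _]half norm_convex_unitary //.
  by rewrite invr_ge0 ler0n.
by rewrite invf_le1 ?ltr0n // ler1n.
Qed.

Definition flipmx (k : nat) : 'M[C]_n :=
  diag_mx (\row_i (if i == k :> nat then -1 else 1)).

Lemma flipmx_unitary k : flipmx k \is unitarymx.
Proof.
apply/unitarymxP; rewrite tr_diag_mx map_diag_mx mulmx_diag -diag_const_mx.
congr diag_mx; apply/rowP=> i; rewrite !mxE.
by case: ifP; rewrite ?rmorphN rmorph1 ?mulrNN mulr1.
Qed.

(** Averaging a matrix with its conjugate by the sign change of coordinate k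
    erases row and column k outside the diagonal and keeps everything else. *)
Lemma norm_pinching A : N (diag_mx (\row_i A i i)) <= N A.
Proof.
(* The off-diagonal entries in the first k rows and columns are erased. *)
pose M k : 'M[C]_n :=
  \matrix_(i, j) (A i j *+ ((i == j) || (k <= i) && (k <= j))%N).
have M0 : M 0%N = A by apply/matrixP=> i j; rewrite mxE orbT.
have Mn : M n = diag_mx (\row_i A i i).
  apply/matrixP=> i j; rewrite !mxE leqNgt ltn_ord orbF.
  by case: eqP => [->|].
have MS k : M k.+1 = 2^-1 *: (M k + flipmx k *m M k *m flipmx k).
  apply/matrixP=> i j; rewrite mul_diag_mx mul_mx_diag !mxE -!val_eqE /=.
  rewrite [(k < i)%N]ltn_neqAle [(k < j)%N]ltn_neqAle !(eq_sym k).
  have [ij|ij] := eqVneq (i : nat) j.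
    by rewrite ij; case: ifP => _; rewrite /= mulr1n; field.
  have [ik|ik] := eqVneq (i : nat) k; have [jk|jk] := eqVneq (j : nat) k.
  - by case/eqP: ij; rewrite ik jk.
  - by rewrite /= mulr0n; field.
  - by rewrite /= andbF mulr0n; field.
  - by rewrite /=; field.
rewrite -Mn -[in leRHS]M0; elim: n => [//|k IH].
by apply: le_trans IH; rewrite MS norm_average ?flipmx_unitary.
Qed.

(** Scaling row k by s in [0, 1] is a convex combination of doing nothing
    (weight (1 + s) / 2) and flipping the sign of that row. *)
Lemma norm_row_scaling (t : 'rV[C]_n) A : (forall i, 0 <= t 0 i <= 1) ->
  N (diag_mx t *m A) <= N A.
Proof.
move=> t01.
pose M k :=
  diag_mx (\row_(i < n) (if (i < k)%N then t 0 i else 1)) *m A.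
have M0 : M 0%N = A.
  rewrite /M -[RHS]mul1mx -diag_const_mx.
  by congr (diag_mx _ *m _); apply/rowP=> i; rewrite !mxE.
have Mn : M n = diag_mx t *m A.
  by congr (diag_mx _ *m _); apply/rowP=> i; rewrite mxE ltn_ord.
suff H k : (k <= n)%N -> N (M k) <= N A by rewrite -Mn H.
elim: k => [|k IH] kn; first by rewrite M0.
apply: le_trans (IH (ltnW kn)).
have /andP[s0 s1] := t01 (Ordinal kn); set s := t 0 _ in s0 s1.
have -> : M k.+1 = (1 + s) / 2 *: M k
    + (1 - (1 + s) / 2) *: (flipmx k *m M k *m 1%:M).
  rewrite mulmx1; apply/matrixP=> i j; rewrite /M !mul_diag_mx.
  rewrite !mxE ltnS leq_eqVlt.
  have [ik|ik] := eqVneq (val i) k; last by rewrite /=; field.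
  rewrite /= ik ltnn; have -> : t 0 i = s by congr (t 0 _); apply: val_inj.
  by field.
apply: norm_convex_unitary; rewrite ?flipmx_unitary //.
- by rewrite divr_ge0 ?addr_ge0 ?ler01 ?ler0n.
- by rewrite ler_pdivrMr ?ltr0n // mul1r -[2]/(1 + 1) lerD2l.
- by apply/unitarymxP; rewrite adjmx1 mulmx1.
Qed.

(** With A = U^* diag(a) U and b = U B U^*, positivity of B - A gives
    a_i <= b_ii, so diag(a) is obtained from b by pinching and then scaling
    the rows by a_i / b_ii. *)
Lemma norm_psdmx_le A B : psdmx A -> psdmx (B - A) -> N A <= N B.
Proof.
move=> pA pBA; have [E a0] := psdmx_spectral pA.
move: (spectralmx A) (spectral_diag A) (spectral_unitarymx A) E a0.
move=> U a uU E a0.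
rewrite invmx_unitary // in E.
have uUs : U^t* \is unitarymx by rewrite trmxC_unitary.
pose b := U *m B *m U^t*.
have ab i : a 0 i <= b i i.
  have := psdmx_diag_ge0 i (psdmx_congr (U^t*) pBA).
  rewrite trmxCK mulmxBr mulmxBl {1}E !mulmxA (unitarymx_mulmxV uU) mul1mx.
  rewrite -(mulmxA (diag_mx a)) (unitarymx_mulmxV uU) mulmx1 -/b.
  by rewrite mxE [(- diag_mx a) i i]mxE [diag_mx a i i]mxE eqxx mulr1n subr_ge0.
rewrite {1}E (symmetric_norm_unitary hN) //.
rewrite -(symmetric_norm_unitary hN B uU uUs).
apply: le_trans (norm_pinching b); move: b ab => b ab.
pose t := \row_i (a 0 i / b i i).
have -> : diag_mx a = diag_mx t *m diag_mx (\row_i b i i).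
  rewrite mulmx_diag; congr diag_mx; apply/rowP=> i; rewrite !mxE.
  have [b0|b0] := eqVneq (b i i) 0; last by rewrite divfK.
  by apply/eqP; rewrite b0 mulr0 eq_le a0 andbT -b0 ab.
apply: norm_row_scaling => i; rewrite mxE.
have b0 : 0 <= b i i by apply: le_trans (ab i).
rewrite divr_ge0 //=; have [->|b1] := eqVneq (b i i) 0.
  by rewrite invr0 mulr0 ler01.
by rewrite ler_pdivrMr ?mul1r // lt_def b1.
Qed.

End NormMonotonicity.

Theorem corollary3p7 (R : realType) (n m : nat) (X : 'I_m -> 'M[R[i]]_n)
    (hX : polar_hermitian (\sum_(k < m) X k))
    (N : 'M[R[i]]_n -> R) (hN : symmetric_norm N) :
  N (symabsmx (\sum_(k < m) X k)) <= N (\sum_(k < m) symabsmx (X k)).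
Proof.
have [V uV pG] := symabsmx_sum_le hX.
apply: le_trans (norm_psdmx_le hN (psdmx_symabsmx _) pG) _.
by rewrite norm_average ?trmxC_unitary.
Qed.
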